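(* Let $F$ be a field in which $3$ is invertible, let $D\in \mathrm{Der}_{\mathbb Z}(F)$ be an absolute derivation, and let $V_3$ be a $3$-dimensional $F$-vector space with a fixed volume form. Then the square $$\begin{array}{ccc} C_5(3) & \xrightarrow{\;d\;} & C_4(3)\\ {\scriptstyle\tau^3_1}\downarrow & & \downarrow{\scriptstyle\tau^3_0}\\ \left(\beta^D_2(F)\otimes F^\times\right)\oplus\left(F\otimes \mathcal{B}_2(F)\right) & \xrightarrow{\;\partial^D\;} & F\otimes\bigwedge^2F^\times\end{array}$$ is commutative (modulo $2$-torsion), i.e. $\tau_0^{3}\circ d=\partial^D\circ\tau_1^{3}$ on $C_5(3)$.
   Context: All tensor products are over $\mathbb Z$; $F\otimes A$ is an $F$-vector space via the left factor. $F^{\bullet\bullet}=F\setminus\{0,1\}$. A derivation $D\in\mathrm{Der}_{\mathbb Z}(F)$ is an additive map $D:F\to F$ with $D(ab)=aD(b)+bD(a)$; $D\log a:=D(a)/a$. $\bigwedge^2F^\times=F^\times\otimes F^\times/\langle x\otimes x\rangle$. All identities are understood modulo $2$-torsion. The group $\mathcal B_2(F)$: $\mathbb Z[\mathbb P^1_F\setminus\{0,1,\infty\}]$ modulo the subgroup generated by $\sum_{i=0}^4(-1)^i[r(x_0,\ldots,\hat x_i,\ldots,x_4)]$ for distinct $x_0,\ldots,x_4\in\mathbb P^1_F$, with $r(x_0,x_1,x_2,x_3)=\frac{(x_0-x_3)(x_1-x_2)}{(x_0-x_2)(x_1-x_3)}$; $[x]_2$ is the class of $[x]$. The space $\beta_2(F)$: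 $F[F^{\bullet\bullet}]$ (the $F$-vector space with basis $[a]$, $a\in F^{\bullet\bullet}$) modulo the kernel of the $F$-linear map $F[F^{\bullet\bullet}]\to F\otimes F^\times$, $[a]\mapsto a\otimes a+(1-a)\otimes(1-a)$; $\langle a\rangle_2$ is the class of $[a]$. Put $\llbracket a\rrbracket^D_2=\frac{D(a)}{a(1-a)}\langle a\rangle_2$, and let $\beta^D_2(F)\subset\beta_2(F)$ be the $F$-subspace generated by all $\llbracket a\rrbracket^D_2$, $a\in F^{\bullet\bullet}$. The map $\partial^D:(\beta^D_2(F)\otimes F^\times)\oplus(F\otimes\mathcal B_2(F))\to F\otimes\bigwedge^2F^\times$ is the $F$-linear map $$\partial^D\left(\llbracket a\rrbracket^D_2\otimes b+x\otimes[y]_2\right)=D\log(1-a)\otimes a\wedge b-D\log(a)\otimes(1-a)\wedge b+x\otimes(1-y)\wedge y.$$ Configurations: $C_m(3)$ is the free abelian group generated by $m$-tuples of vectors $(l_0,\ldots,l_{m-1})$ in $V_3$ in generic position (any $3$ or fewer of them are linearly independent), modulo the diagonal action of $GL(V_3)$. $d(l_0,\ldots,l_{m-1})=\sum_{i=0}^{m-1}(-1)^i(l_0,\ldots,\hat l_i,\ldots,l_{m-1})$. With $\omega\in\det V_3^*$ the volume form, $\Delta(l_i,l_j,l_k)=\langle\omega,l_i\wedge l_j\wedge l_k\rangle$. Projected cross-ratio: $r(l_0|l_1,l_2,l_3,l_4)=\frac{\Delta(l_0,l_1,l_4)\Delta(l_0,l_2,l_3)}{\Delta(l_0,l_1,l_3)\Delta(l_0,l_2,l_4)}$.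 For a $5$-tuple $(l_0,\ldots,l_4)$, $\Delta(\hat l_i,\hat l_j)$ denotes the determinant $\Delta$ of the three vectors remaining (in order) after deleting $l_i$ and $l_j$. The maps: $$\tau_0^{3}(l_0,\ldots,l_3)=\sum_{i=0}^3(-1)^{i}D\log\Delta(l_0,\ldots,\hat l_i,\ldots,l_3)\otimes\frac{\Delta(l_0,\ldots,\hat l_{i+1},\ldots,l_3)}{\Delta(l_0,\ldots,\hat l_{i+2},\ldots,l_3)}\wedge\frac{\Delta(l_0,\ldots,\hat l_{i+3},\ldots,l_3)}{\Delta(l_0,\ldots,\hat l_{i+2},\ldots,l_3)}$$ (indices mod $4$), and $$\tau_1^{3}(l_0,\ldots,l_4)=-\frac13\sum_{i=0}^4(-1)^i\Big\{\llbracket r(l_i|l_0,\ldots,\hat l_i,\ldots,l_4)\rrbracket^D_2\otimes\prod_{j\ne i}\Delta(\hat l_i,\hat l_j)+D\log\Big(\prod_{j\neq i}\Delta(\hat l_i,\hat l_j)\Big)\otimes[r(l_i|l_0,\ldots,\hat l_i,\ldots,l_4)]_2\Big\}.$$ *)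

(* Defs.v *)
From HB Require Import structures.
From mathcomp Require Import all_boot all_order all_algebra.
From mathcomp Require Import boolp.
From mathcomp Require Import ring.
From mathcomp Require Import freeg.

Set Implicit Arguments.
Unset Strict Implicit.
Unset Printing Implicit Defensive.

Import GRing.Theory.
Local Open Scope ring_scope.
Local Open Scope quotient_scope.

(** * Free groups, subgroups, quotients *)

Section FreeLift.
Variables (R : nzRingType) (T : choiceType) (M : lmodType R) (f : T -> M).

Lemma fglift_linear : linear (fglift f).
Proof.
have fgD x y : fglift f (x + y) = fglift f x + fglift f y.
  have fgB := lift_is_additive f.
  have fg0 : fglift f 0 = 0 by rewrite -(subrr 0) fgB subrr.
  have fgN u : fglift f (- u) = - fglift f u by rewrite -(sub0r u) fgB fg0 sub0r.
  by rewrite -[y in LHS]opprK fgB fgN opprK.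
have fg0 : fglift f 0 = 0 by apply: (addrI (fglift f 0)); rewrite -fgD !addr0.
have fgZ c x : fglift f (c *: x) = c *: fglift f x.
  elim/freeg_ind_dom0: x => [|k t x _ _ IH]; first by rewrite scaler0 fg0 scaler0.
  have -> : c *: (<< k *g t >> + x) = << c * k *g t >> + c *: x.
    by rewrite scalerDr; congr (_ + _); apply/eqP/freeg_eqP => z;
       rewrite coeffZ !coeffU mulrA.
  by rewrite !fgD !liftU IH scalerDr scalerA.
by move=> c x y; rewrite fgD fgZ.
Qed.

HB.instance Definition _ :=
  GRing.isLinear.Build R {freeg T / R} M _ (fglift f) fglift_linear.

End FreeLift.

(* The additive extension of f to the free abelian group Z[T] = {freeg T}. *)
Definition zlift (T : choiceType) (U : zmodType) (f : T -> U) (x : {freeg T}) : U :=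
  fglift (f : T -> zmodule U) x.

Lemma zlift_additive (T : choiceType) (U : zmodType) (f : T -> U) : zmod_morphism (@zlift T U f).
Proof. by move=> x y; rewrite /zlift linearB. Qed.
HB.instance Definition _ (T : choiceType) (U : zmodType) (f : T -> U) :=
  GRing.isZmodMorphism.Build {freeg T} U (@zlift T U f) (zlift_additive f).

Lemma zliftU (T : choiceType) (U : zmodType) (f : T -> U) t :
  zlift f << t >> = f t.
Proof. by rewrite /zlift liftU scale1r. Qed.

Lemma freegZ1 (T : choiceType) (k : int) (t : T) :
  << k *g t >> = << t >> *~ k :> {freeg T}.
Proof. by rewrite freegU_mulz intz. Qed.

Lemma zfree_ext (T : choiceType) (U : zmodType) (f g : {additive {freeg T} -> U}) :
  (forall t, f << t >> = g << t >>) -> f =1 g.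
Proof.
move=> fg; elim/freeg_ind_dom0 => [|k t x _ _ IH]; first by rewrite !raddf0.
by rewrite !raddfD IH freegZ1 !raddfMz /= fg.
Qed.

(* The subgroup of M generated by S. *)
Inductive zspan (M : zmodType) (S : M -> Prop) : M -> Prop :=
  | zspan0 : zspan S 0
  | zspan_gen x : S x -> zspan S x
  | zspanB x y : zspan S x -> zspan S y -> zspan S (x - y).

Definition zspanb (M : zmodType) (S : M -> Prop) : pred M :=
  fun x => `[< zspan S x >].

Lemma zspanb_closed (M : zmodType) (S : M -> Prop) : zmod_closed (zspanb S).
Proof.
split=> [|x y]; first exact/asboolP/zspan0.
by move=> /asboolP xS /asboolP yS; apply/asboolP/zspanB.
Qed.
HB.instance Definition _ M S :=
  GRing.isZmodClosed.Build M (@zspanb M S) (zspanb_closed S).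

Definition zquot (M : zmodType) (S : M -> Prop) :=
  @Quotient.quot M (GRing.ZmodClosed.clone M (zspanb S) _).
HB.instance Definition _ M S := GRing.Zmodule.on (@zquot M S).

Definition zcl (M : zmodType) (S : M -> Prop) (x : M) : zquot S :=
  \pi_(zquot S) x.

Lemma zcl_additive M S : zmod_morphism (@zcl M S).
Proof. by move=> x y; rewrite /zcl raddfB. Qed.
HB.instance Definition _ M S :=
  GRing.isZmodMorphism.Build M (zquot S) (@zcl M S) (zcl_additive S).

(* The map induced on M/<S> by f; [zdescendE] is the factorization property,
   valid for additive f vanishing on S. *)
Definition zdescend (M : zmodType) (S : M -> Prop) (U : Type) (f : M -> U)
  (x : zquot S) : U := f (repr x).

Lemma zcl_rel (M : zmodType) (S : M -> Prop) x : S x -> zcl S x = 0.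
Proof.
move=> Sx; rewrite -[RHS](raddf0 (zcl S)); apply/eqP.
rewrite /zcl -Quotient.idealrBE subr0; exact/asboolP/zspan_gen.
Qed.

Lemma zclW (M : zmodType) (S : M -> Prop) (P : zquot S -> Prop) :
  (forall x, P (zcl S x)) -> forall q, P q.
Proof. by move=> H q; have := H (repr q); rewrite /zcl reprK. Qed.

Section ZDescend.
Variables (M : zmodType) (S : M -> Prop) (U : zmodType) (f : {additive M -> U}).
Hypothesis fS : forall x, S x -> f x = 0.

Lemma zdescendE x : zdescend f (zcl S x) = f x.
Proof.
apply/eqP; rewrite -subr_eq0 -raddfB; apply/eqP.
have : repr (zcl S x) - x \in GRing.ZmodClosed.clone M (zspanb S) _.
  by rewrite Quotient.idealrBE reprK.
move=> /asboolP; elim=> [||u v _ fu _ fv]; rewrite ?raddf0 //.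
by rewrite raddfB fu fv subrr.
Qed.

Lemma zdescend_additive : zmod_morphism (zdescend (S := S) f).
Proof.
move=> p q; elim/zclW: p => x; elim/zclW: q => y.
by rewrite -raddfB !zdescendE raddfB.
Qed.
End ZDescend.

(* M / ker f, for a linear map f. *)
Section Coimage.
Variables (R : nzRingType) (M U : lmodType R) (f : {linear M -> U}).

Definition kerb : pred M := fun x => f x == 0.

Lemma kerb_closed : zmod_closed kerb.
Proof.
split=> [|x y]; rewrite !unfold_in ?linear0 // => /eqP fx /eqP fy.
by rewrite linearB fx fy subrr.
Qed.
HB.instance Definition _ := GRing.isZmodClosed.Build M kerb kerb_closed.

Definition coim := @Quotient.quot M (GRing.ZmodClosed.clone M kerb _).
HB.instance Definition _ := GRing.Zmodule.on coim.

Definition coim_cl (x : M) : coim := \pi_coim x.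
Definition coim_map (q : coim) : U := f (repr q).

Lemma coim_mapE x : coim_map (coim_cl x) = f x.
Proof.
apply/eqP; rewrite -subr_eq0 -linearB.
have : repr (coim_cl x) - x \in GRing.ZmodClosed.clone M kerb _.
  by rewrite Quotient.idealrBE reprK.
by [].
Qed.

Lemma coim_map_inj : injective coim_map.
Proof.
move=> p q /eqP; rewrite -subr_eq0 -linearB -[_ == 0]/(_ \in kerb) => pq.
rewrite -[p]reprK -[q]reprK; apply/eqP.
by rewrite -Quotient.idealrBE.
Qed.

Lemma coim_cl_additive : zmod_morphism coim_cl.
Proof. by move=> x y; rewrite /coim_cl raddfB. Qed.
HB.instance Definition _ :=
  GRing.isZmodMorphism.Build M coim coim_cl coim_cl_additive.

Lemma coim_map_additive : zmod_morphism coim_map.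
Proof.
move=> p q; rewrite -[p]reprK -[q]reprK -![\pi _]/(coim_cl _).
by rewrite -raddfB !coim_mapE linearB.
Qed.
HB.instance Definition _ :=
  GRing.isZmodMorphism.Build coim U coim_map coim_map_additive.

Definition coim_scale (c : R) (q : coim) : coim := coim_cl (c *: repr q).

Lemma coim_scaleE c q : coim_map (coim_scale c q) = c *: coim_map q.
Proof. by rewrite coim_mapE linearZ. Qed.

Lemma coim_scaleA a b q : coim_scale a (coim_scale b q) = coim_scale (a * b) q.
Proof. by apply: coim_map_inj; rewrite !coim_scaleE scalerA. Qed.
Lemma coim_scale1 q : coim_scale 1 q = q.
Proof. by apply: coim_map_inj; rewrite !coim_scaleE scale1r. Qed.
Lemma coim_scaleDr c p q : coim_scale c (p + q) = coim_scale c p + coim_scale c q.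
Proof. by apply: coim_map_inj; rewrite raddfD /= !coim_scaleE raddfD scalerDr. Qed.
Lemma coim_scaleDl q a b : coim_scale (a + b) q = coim_scale a q + coim_scale b q.
Proof. by apply: coim_map_inj; rewrite raddfD /= !coim_scaleE scalerDl. Qed.

HB.instance Definition _ := GRing.Zmodule_isLmodule.Build R coim
  coim_scaleA coim_scale1 coim_scaleDr coim_scaleDl.

Lemma coim_mapZ c q : coim_map (c *: q) = c *: coim_map q.
Proof. exact: coim_scaleE. Qed.

End Coimage.

Arguments coim_cl : simpl never.
Arguments coim_map : simpl never.

(* The R-submodule of M generated by S. *)
Inductive lspan (R : nzRingType) (M : lmodType R) (S : M -> Prop) : M -> Prop :=
  | lspan0 : lspan S 0
  | lspan_gen x : S x -> lspan S x
  | lspanD c x y : lspan S x -> lspan S y -> lspan S (c *: x + y).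

Section LSpan.
Variables (R : nzRingType) (M : lmodType R) (S : M -> Prop).

Definition lspanb : pred M := fun x => `[< lspan S x >].

Lemma lspanb_closed : submod_closed lspanb.
Proof.
split=> [|c x y]; first exact/asboolP/lspan0.
by move=> /asboolP xS /asboolP yS; apply/asboolP/lspanD.
Qed.
HB.instance Definition _ := GRing.isSubmodClosed.Build R M lspanb lspanb_closed.

Definition lspan_of := {x : M | lspanb x}.
HB.instance Definition _ := SubChoice.on lspan_of.
HB.instance Definition _ := [SubChoice_isSubLmodule of lspan_of by <:].
End LSpan.

(** * Tensor products over Z *)

Section Tensor.
Variables (A B : zmodType).

Inductive bilin_rel : {freeg A * B} -> Prop :=
  | bilin_l x x' y :
      bilin_rel (<< (x + x', y) >> - << (x, y) >> - << (x', y) >>)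
  | bilin_r x y y' :
      bilin_rel (<< (x, y + y') >> - << (x, y) >> - << (x, y') >>).

Definition tensor := zquot bilin_rel.
HB.instance Definition _ := GRing.Zmodule.on tensor.

Definition tens (x : A) (y : B) : tensor := zcl bilin_rel << (x, y) >>.

Lemma tensDl x x' y : tens (x + x') y = tens x y + tens x' y.
Proof.
apply/eqP; rewrite -subr_eq0 opprD addrA /tens -!raddfB /=; apply/eqP/zcl_rel.
exact: bilin_l.
Qed.

Lemma tensDr x y y' : tens x (y + y') = tens x y + tens x y'.
Proof.
apply/eqP; rewrite -subr_eq0 opprD addrA /tens -!raddfB /=; apply/eqP/zcl_rel.
exact: bilin_r.
Qed.

Lemma tens0l y : tens 0 y = 0.
Proof. by apply: (addrI (tens 0 y)); rewrite -tensDl !addr0. Qed.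
Lemma tens0r x : tens x 0 = 0.
Proof. by apply: (addrI (tens x 0)); rewrite -tensDr !addr0. Qed.
Lemma tensNl x y : tens (- x) y = - tens x y.
Proof. by apply: (addrI (tens x y)); rewrite -tensDl !subrr tens0l. Qed.
Lemma tensNr x y : tens x (- y) = - tens x y.
Proof. by apply: (addrI (tens x y)); rewrite -tensDr !subrr tens0r. Qed.

Lemma tensor_ext (U : zmodType) (f g : {additive tensor -> U}) :
  (forall x y, f (tens x y) = g (tens x y)) -> f =1 g.
Proof.
move=> fg q; elim/zclW: q => x.
apply: (@zfree_ext _ _ (f \o zcl bilin_rel) (g \o zcl bilin_rel)) => -[a b].
exact: fg.
Qed.

Section TLift.
Variables (U : zmodType) (f : A -> B -> U).

(* The additive map with x (x) y |-> f x y, for biadditive f. *)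
Definition tlift : tensor -> U :=
  zdescend (zlift (fun p : A * B => f p.1 p.2)).

Hypothesis fDl : forall x x' y, f (x + x') y = f x y + f x' y.
Hypothesis fDr : forall x y y', f x (y + y') = f x y + f x y'.

Lemma tlift_rel x : bilin_rel x -> zlift (fun p : A * B => f p.1 p.2) x = 0.
Proof.
by case=> *; rewrite !raddfB /= !zliftU /= ?fDl ?fDr addrAC addrK subrr.
Qed.

Lemma tliftE x y : tlift (tens x y) = f x y.
Proof. by rewrite /tlift (zdescendE tlift_rel) /= zliftU. Qed.

Lemma tlift_additive : zmod_morphism tlift.
Proof. exact/zdescend_additive/tlift_rel. Qed.

End TLift.
End Tensor.

Notation "x ⊗ y" := (tens x y) (at level 40, left associativity) : ring_scope.

(* A (x) B is a left R-module through A. *)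
Section TensorLmodule.
Variables (R : nzRingType) (A : lmodType R) (B : zmodType).

Definition tens_scale (c : R) : tensor A B -> tensor A B :=
  tlift (fun x y => (c *: x) ⊗ y).

Lemma tens_scaleE c x y : tens_scale c (x ⊗ y) = (c *: x) ⊗ y.
Proof. by rewrite /tens_scale tliftE // => *; rewrite ?scalerDr ?tensDl ?tensDr. Qed.

Lemma tens_scale_additive c : zmod_morphism (tens_scale c).
Proof. by apply: tlift_additive => *; rewrite ?scalerDr ?tensDl ?tensDr. Qed.
HB.instance Definition _ c := GRing.isZmodMorphism.Build (tensor A B) (tensor A B)
  (tens_scale c) (tens_scale_additive c).

Lemma tens_scaleA a b q : tens_scale a (tens_scale b q) = tens_scale (a * b) q.
Proof.
apply: (tensor_ext (f := tens_scale a \o tens_scale b)) => x y /=.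
by rewrite !tens_scaleE scalerA.
Qed.
Lemma tens_scale1 q : tens_scale 1 q = q.
Proof.
by apply: (tensor_ext (g := idfun)) => x y /=; rewrite tens_scaleE scale1r.
Qed.
Lemma tens_scaleDr c p q : tens_scale c (p + q) = tens_scale c p + tens_scale c q.
Proof. exact: raddfD. Qed.
Lemma tens_scaleDl q a b : tens_scale (a + b) q = tens_scale a q + tens_scale b q.
Proof.
apply: (tensor_ext (g := tens_scale a \+ tens_scale b)) => x y /=.
by rewrite !tens_scaleE scalerDl tensDl.
Qed.

HB.instance Definition _ := GRing.Zmodule_isLmodule.Build R (tensor A B)
  tens_scaleA tens_scale1 tens_scaleDr tens_scaleDl.

Lemma tensZl c x y : c *: (x ⊗ y) = (c *: x) ⊗ y.
Proof. exact: tens_scaleE. Qed.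
End TensorLmodule.

(** * The groups attached to the field F *)

(* F^x, a Z-module: its group law, the multiplication of F, is written
   additively. *)
Section MulGroup.
Variable F : fieldType.

Definition Fx := {x : F | x != 0}.
HB.instance Definition _ := Choice.on Fx.

Definition Fx_add (u v : Fx) : Fx :=
  exist _ (val u * val v) (mulf_neq0 (valP u) (valP v)).
Definition Fx_opp (u : Fx) : Fx :=
  exist _ (val u)^-1 (invr_neq0 (valP u)).
Definition Fx_zero : Fx := exist _ 1 (oner_neq0 F).

Lemma Fx_addA : associative Fx_add.
Proof. by move=> u v w; apply: val_inj; rewrite /= mulrA. Qed.
Lemma Fx_addC : commutative Fx_add.
Proof. by move=> u v; apply: val_inj; rewrite /= mulrC. Qed.
Lemma Fx_add0 : left_id Fx_zero Fx_add.
Proof. by move=> u; apply: val_inj; rewrite /= mul1r. Qed.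
Lemma Fx_addN : left_inverse Fx_zero Fx_opp Fx_add.
Proof. by move=> u; apply: val_inj; rewrite /= mulVf ?(valP u). Qed.
HB.instance Definition _ :=
  GRing.isZmodule.Build Fx Fx_addA Fx_addC Fx_add0 Fx_addN.

(* x as an element of F^x, for x != 0. *)
Definition ux (x : F) : Fx := insubd Fx_zero x.

Lemma val_ux x : x != 0 -> val (ux x) = x.
Proof. by move=> x0; rewrite /ux insubdK. Qed.
Lemma uxM x y : x != 0 -> y != 0 -> ux (x * y) = ux x + ux y.
Proof.
by move=> x0 y0; apply: val_inj; rewrite /= !val_ux ?mulf_neq0.
Qed.
Lemma ux1 : ux 1 = 0.
Proof. by apply: val_inj; rewrite val_ux ?oner_neq0. Qed.
Lemma uxV x : x != 0 -> ux x^-1 = - ux x.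
Proof.
by move=> x0; apply: (addrI (ux x)); rewrite -uxM ?invr_neq0 // mulfV // ux1 subrr.
Qed.
Lemma uxf x y : x != 0 -> y != 0 -> ux (x / y) = ux x - ux y.
Proof. by move=> x0 y0; rewrite uxM ?invr_neq0 // uxV. Qed.

(* /\^2 F^x *)
Inductive alt_rel : tensor Fx Fx -> Prop :=
  | alt_rel_sq u : alt_rel (u ⊗ u).

Definition Fx_wedge2 := zquot alt_rel.
HB.instance Definition _ := GRing.Zmodule.on Fx_wedge2.

Definition wedge (u v : Fx) : Fx_wedge2 := zcl alt_rel (u ⊗ v).

Lemma wedgeDl u u' v : wedge (u + u') v = wedge u v + wedge u' v.
Proof. by rewrite /wedge tensDl raddfD. Qed.
Lemma wedgeDr u v v' : wedge u (v + v') = wedge u v + wedge u v'.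
Proof. by rewrite /wedge tensDr raddfD. Qed.
Lemma wedgexx u : wedge u u = 0.
Proof. exact/zcl_rel/alt_rel_sq. Qed.
End MulGroup.

Notation "u ∧ v" := (wedge u v) (at level 35, no associativity) : ring_scope.

(* F^** = F \ {0, 1} *)
Definition Fbb (F : fieldType) := {a : F | (a != 0) && (a != 1)}.
HB.instance Definition _ (F : fieldType) := Choice.on (Fbb F).

(* f a for a in F^** (and 0 otherwise). *)
Definition on_Fbb (F : fieldType) (U : zmodType) (f : Fbb F -> U) (a : F) : U :=
  oapp f 0 (insub a).

(* P^1(F) = F + {oo}, with oo = None; [pdiff x y] is x - y, as the determinant
   of the homogeneous coordinates (x : 1), (y : 1), resp. (1 : 0) for oo, so
   that [cross_ratio] below also has its usual value when some x_i is oo. *)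
Definition P1 (F : fieldType) := option F.
HB.instance Definition _ (F : fieldType) := Choice.on (P1 F).

Definition pdiff (F : fieldType) (x y : P1 F) : F :=
  match x, y with
  | Some a, Some b => a - b
  | None, Some _ => 1
  | Some _, None => -1
  | None, None => 0
  end.

Definition cross_ratio (F : fieldType) (x0 x1 x2 x3 : P1 F) : F :=
  (pdiff x0 x3 * pdiff x1 x2) / (pdiff x0 x2 * pdiff x1 x3).

(* The subfamily, in order, of the x_k with k not in A. *)
Definition omit (n : nat) (T : Type) (A : pred 'I_n) (x : 'I_n -> T) : seq T :=
  [seq x k | k <- enum 'I_n & ~~ A k].

(** ** B_2(F) *)
Section B2.
Variable F : fieldType.

Definition cross_ratio_omit (x : {ffun 'I_5 -> P1 F}) (i : 'I_5) : F :=
  let s := omit (pred1 i) x in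
  cross_ratio (nth None s 0) (nth None s 1) (nth None s 2) (nth None s 3).

Inductive five_term_rel : {freeg (Fbb F)} -> Prop :=
  | five_term (x : {ffun 'I_5 -> P1 F}) : injective x ->
      five_term_rel (\sum_(i < 5) (-1) ^+ i *:
        on_Fbb (fun a => << a >>) (cross_ratio_omit x i)).

Definition B2 := zquot five_term_rel.
HB.instance Definition _ := GRing.Zmodule.on B2.

Definition B2_cl (a : Fbb F) : B2 := zcl five_term_rel << a >>.

Definition delta2 : B2 -> Fx_wedge2 F :=
  zdescend (zlift (fun a : Fbb F => ux (1 - val a) ∧ ux (val a))).
End B2.

(** ** beta_2(F) *)
Section Beta2.
Variable F : fieldType.

Definition beta2_map : {freeg (Fbb F) / F} -> tensor F^o (Fx F) :=
  fglift (fun a : Fbb F => (val a : F^o) ⊗ ux (val a)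
                           + (1 - val a : F^o) ⊗ ux (1 - val a)).
Lemma beta2_map_linear : linear beta2_map.
Proof. exact: fglift_linear. Qed.
HB.instance Definition _ := GRing.isLinear.Build F {freeg (Fbb F) / F}
  (tensor F^o (Fx F)) _ beta2_map beta2_map_linear.

Definition beta2 := coim beta2_map.
HB.instance Definition _ := GRing.Lmodule.on beta2.

Definition beta2_cl (a : Fbb F) : beta2 := coim_cl beta2_map << a >>.

End Beta2.

(** ** Derivations and beta_2^D(F) *)
Record derivation (F : fieldType) (D : F -> F) : Prop := {
  derD : forall a b, D (a + b) = D a + D b;
  derM : forall a b, D (a * b) = a * D b + b * D a
}.

Section Beta2D.
Variables (F : fieldType) (D : F -> F).

Definition dlog (a : F) : F := D a / a.

(* [[a]]_2^D as an element of beta_2(F) *)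
Definition dbr_val (a : Fbb F) : beta2 F :=
  (D (val a) / (val a * (1 - val a))) *: beta2_cl a.

Definition beta2D := lspan_of (fun x : beta2 F => exists a, x = dbr_val a).
HB.instance Definition _ := GRing.Lmodule.on beta2D.

Lemma dbr_subproof a : lspanb (fun x => exists a, x = dbr_val a) (dbr_val a).
Proof. by apply/asboolP/lspan_gen; exists a. Qed.

Definition dbr (a : Fbb F) : beta2D := exist _ (dbr_val a) (dbr_subproof a).

(* The restriction to beta_2^D(F) of the injection beta_2(F) -> F (x) F^x
   induced by [beta2_map]. *)
Definition beta2D_log (q : beta2D) : tensor F^o (Fx F) := coim_map (val q).

Lemma beta2D_log_linear : linear beta2D_log.
Proof. by move=> c p q; rewrite /beta2D_log linearP raddfD /= coim_mapZ. Qed.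
HB.instance Definition _ := GRing.isLinear.Build F beta2D
  (tensor F^o (Fx F)) _ beta2D_log beta2D_log_linear.

Lemma beta2D_log_inj : injective beta2D_log.
Proof. by move=> p q /coim_map_inj/val_inj. Qed.

(* x (x) u |-> x (x) (u /\ b) *)
Definition wedge_right (b : Fx F) : tensor F^o (Fx F) -> tensor F^o (Fx_wedge2 F) :=
  tlift (fun x u => x ⊗ (u ∧ b)).

(* [beta2D_log] sends [[a]]_2^D to Dlog(a) (x) (1-a) - Dlog(1-a) (x) a, whence
   the formula on generators, [partialDE] below. *)
Definition partialD :
    (tensor beta2D (Fx F) * tensor F^o (B2 F))%type -> tensor F^o (Fx_wedge2 F) :=
  fun p =>
    tlift (fun (q : beta2D) b => - wedge_right b (beta2D_log q)) p.1
    + tlift (fun (x : F^o) y => x ⊗ delta2 y) p.2.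
End Beta2D.

Arguments beta2D_log : simpl never.

(** * Configurations *)

Section Configurations.
Variables (F : fieldType) (V : vectType F).

(* Nonzero elements of the top exterior power of V^*, for V of dimension 3. *)
Record volume_form (w : V -> V -> V -> F) : Prop := {
  vol_lin1 : forall c x x' y z, w (c *: x + x') y z = c * w x y z + w x' y z;
  vol_lin2 : forall c x y y' z, w x (c *: y + y') z = c * w x y z + w x y' z;
  vol_lin3 : forall c x y z z', w x y (c *: z + z') = c * w x y z + w x y z';
  vol_alt12 : forall x z, w x x z = 0;
  vol_alt23 : forall x y, w x y y = 0;
  vol_alt13 : forall x y, w x y x = 0;
  vol_neq0 : exists x y z, w x y z != 0
}.

Definition generic (m : nat) (l : {ffun 'I_m -> V}) : bool :=
  [forall A : {set 'I_m}, (#|A| <= 3)%N ==> free [seq l i | i <- enum A]].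

Definition gtuple (m : nat) := {l : {ffun 'I_m -> V} | generic l}.
HB.instance Definition _ m := Choice.on (gtuple m).

Inductive GL_rel (m : nat) : {freeg (gtuple m)} -> Prop :=
  | GL_act (g : 'End(V)) (l l' : gtuple m) :
      lker g == 0%VS -> (forall i, val l' i = g (val l i)) ->
      GL_rel (<< l' >> - << l >>).

(* C_m(3), when V has dimension 3 *)
Definition Cfg (m : nat) := zquot (@GL_rel m).
HB.instance Definition _ m := GRing.Zmodule.on (Cfg m).

Definition cfg_cl (m : nat) (l : gtuple m) : Cfg m := zcl (@GL_rel m) << l >>.

Definition del_val (m : nat) (i : 'I_m.+1) (l : {ffun 'I_m.+1 -> V}) :
  {ffun 'I_m -> V} := [ffun j => l (fintype.lift i j)].

Lemma del_generic m i (l : {ffun 'I_m.+1 -> V}) :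
  generic l -> generic (del_val i l).
Proof.
move=> /forallP gl; apply/forallP => A; apply/implyP => cA.
have := gl (fintype.lift i @: A); rewrite card_imset; last exact: lift_inj.
rewrite cA /= => fA; rewrite -(perm_free (X := [seq l j | j <- enum (fintype.lift i @: A)])) //.
under [X in perm_eq _ X]eq_map => j do rewrite ffunE.
rewrite (map_comp l (fintype.lift i)); apply/perm_map/uniq_perm; rewrite ?enum_uniq //.
  by rewrite map_inj_uniq ?enum_uniq //; apply: lift_inj.
move=> j; rewrite mem_enum; apply/imsetP/mapP => -[k kA ->]; exists k => //.
  by rewrite mem_enum.
by rewrite mem_enum in kA.
Qed.

Definition del (m : nat) (i : 'I_m.+1) (l : gtuple m.+1) : gtuple m :=
  exist _ (del_val i (val l)) (del_generic i (valP l)).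

Definition cfg_d (m : nat) : Cfg m.+1 -> Cfg m :=
  zdescend (zlift (fun l : gtuple m.+1 =>
    \sum_(i < m.+1) cfg_cl (del i l) *~ (-1) ^+ i)).

Variables (D : F -> F) (w : V -> V -> V -> F).

(* Delta of the three vectors remaining, in order, after deletion of the l_k
   with k in A *)
Definition Delta_omit (n : nat) (A : pred 'I_n) (l : 'I_n -> V) : F :=
  let s := omit A l in w s`_0 s`_1 s`_2.

(* r(l0 | l1, l2, l3, l4) *)
Definition proj_cross_ratio (l0 l1 l2 l3 l4 : V) : F :=
  (w l0 l1 l4 * w l0 l2 l3) / (w l0 l1 l3 * w l0 l2 l4).

Definition proj_cross_ratio_omit (l : 'I_5 -> V) (i : 'I_5) : F :=
  let s := omit (pred1 i) l in proj_cross_ratio (l i) s`_0 s`_1 s`_2 s`_3.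

(* Indices are in Z/4: + on 'I_4 is the addition mod 4. *)
Definition tau0_gen (l : gtuple 4) : tensor F^o (Fx_wedge2 F) :=
  let Dl i := Delta_omit (pred1 i) (val l) in
  \sum_(i < 4) (-1) ^+ i *:
    ((dlog D (Dl i) : F^o) ⊗
       (ux (Dl (i + 1) / Dl (i + 2%:R)) ∧ ux (Dl (i + 3%:R) / Dl (i + 2%:R)))).

Definition tau0 : Cfg 4 -> tensor F^o (Fx_wedge2 F) := zdescend (zlift tau0_gen).

Definition tau1_gen (l : gtuple 5) :
    (tensor (beta2D D) (Fx F) * tensor F^o (B2 F))%type :=
  let r i := proj_cross_ratio_omit (val l) i in
  let P i := \prod_(j < 5 | j != i) Delta_omit (pred2 i j) (val l) in
  - 3%:R^-1 *: \sum_(i < 5) (-1) ^+ i *: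
    (on_Fbb (@dbr F D) (r i) ⊗ ux (P i),
     (dlog D (P i) : F^o) ⊗ on_Fbb (@B2_cl F) (r i)).

Definition tau1 :
    Cfg 5 -> (tensor (beta2D D) (Fx F) * tensor F^o (B2 F))%type :=
  zdescend (zlift tau1_gen).

End Configurations.

Arguments cfg_d {F V} m.

Definition eq_mod_2torsion (U : zmodType) (x y : U) : Prop := (x - y) *+ 2 = 0.

(* Main.v *)
Require Import Defs.
From HB Require Import structures.
From mathcomp Require Import all_boot all_order all_algebra.
From mathcomp Require Import ring.
From mathcomp Require Import freeg.
Import GRing.Theory.
Local Open Scope ring_scope.
Set Implicit Arguments.
Unset Strict Implicit.
Unset Printing Implicit Defensive.

(** Fix a generic 5-tuple. The projected cross-ratios r, by the Plücker relation
    also 1 - r, and the products of determinants are all, without any sign,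
    monomials in the ten ordered determinants Delta(^l_i, ^l_j): in r and in
    1 - r each of the four projected vectors occurs once in the numerator and
    once in the denominator, so that the signs from reordering cancel. Hence
    both composites are integral combinations of the symbols
    Dlog Delta ⊗ (Delta' ∧ Delta''), and after multiplication by 3 the theorem
    becomes a formal identity between such combinations, checked by computing
    its coefficients up to antisymmetry. The identity is exact, not only modulo
    2-torsion. *)

(** * Formal identities in /\^2 F^x and F ⊗ /\^2 F^x *)

Section TensorWedge.

Lemma tens_sumr (A B : zmodType) (I : Type) (s : seq I) (x : A) (y : I -> B) :
  x ⊗ (\sum_(i <- s) y i) = \sum_(i <- s) x ⊗ y i.
Proof. exact: (big_morph (fun z => x ⊗ z) (tensDr x) (tens0r _ x)). Qed.

Lemma tens_suml (A B : zmodType) (I : Type) (s : seq I) (x : I -> A) (y : B) :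
  (\sum_(i <- s) x i) ⊗ y = \sum_(i <- s) x i ⊗ y.
Proof. exact: (big_morph (fun z => z ⊗ y) (fun a b => tensDl a b y) (tens0l A y)). Qed.

Lemma tensMzr (A B : zmodType) (x : A) (y : B) k : x ⊗ (y *~ k) = (x ⊗ y) *~ k.
Proof.
elim/int_rect: k => [|k IH|k IH]; first by rewrite !mulr0z tens0r.
  by rewrite -addn1 PoszD !mulrzDr tensDr IH !mulr1z.
by rewrite -addn1 PoszD opprD !mulrzDr tensDr IH !mulrN1z tensNr.
Qed.

Lemma tensMzl (A B : zmodType) (x : A) (y : B) k : (x *~ k) ⊗ y = (x ⊗ y) *~ k.
Proof.
elim/int_rect: k => [|k IH|k IH]; first by rewrite !mulr0z tens0l.
  by rewrite -addn1 PoszD !mulrzDr tensDl IH !mulr1z.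
by rewrite -addn1 PoszD opprD !mulrzDr tensDl IH !mulrN1z tensNl.
Qed.

Variable F : fieldType.
Implicit Types u v : Fx F.

Lemma wedge_suml (I : Type) (s : seq I) (x : I -> Fx F) v :
  (\sum_(i <- s) x i) ∧ v = \sum_(i <- s) (x i ∧ v).
Proof. by rewrite /wedge tens_suml raddf_sum. Qed.

Lemma wedge_sumr (I : Type) (s : seq I) (x : I -> Fx F) v :
  v ∧ (\sum_(i <- s) x i) = \sum_(i <- s) (v ∧ x i).
Proof. by rewrite /wedge tens_sumr raddf_sum. Qed.

Lemma wedgeMzl u v k : (u *~ k) ∧ v = (u ∧ v) *~ k.
Proof. by rewrite /wedge tensMzl raddfMz. Qed.

Lemma wedgeMzr u v k : u ∧ (v *~ k) = (u ∧ v) *~ k.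
Proof. by rewrite /wedge tensMzr raddfMz. Qed.

Lemma wedgeC u v : v ∧ u = - (u ∧ v).
Proof.
apply/eqP; rewrite -addr_eq0; apply/eqP.
by have := wedgexx (v + u); rewrite wedgeDl !wedgeDr !wedgexx add0r addr0.
Qed.

Lemma wedgeNl u v : (- u) ∧ v = - (u ∧ v).
Proof. by rewrite /wedge tensNl raddfN. Qed.

End TensorWedge.

(** * Logarithmic derivatives *)

Section Dlog.
Variables (F : fieldType) (D : F -> F) (hD : derivation D).

Lemma der1 : D 1 = 0.
Proof.
by apply: (addrI (D 1)); rewrite addr0 -[in RHS](mulr1 1) (derM hD) !mul1r.
Qed.

Lemma der0 : D 0 = 0.
Proof. by apply: (addrI (D 0)); rewrite addr0 -(derD hD) addr0. Qed.

Lemma derN a : D (- a) = - D a.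
Proof. by apply: (addrI (D a)); rewrite -(derD hD) !subrr der0. Qed.

Lemma dlogM a b : a != 0 -> b != 0 -> dlog D (a * b) = dlog D a + dlog D b.
Proof. by move=> a0 b0; rewrite /dlog (derM hD); field; rewrite a0 b0. Qed.

Lemma dlogV a : a != 0 -> dlog D a^-1 = - dlog D a.
Proof.
move=> a0; apply: (addrI (dlog D a)).
by rewrite -dlogM ?invr_neq0 // divff // subrr /dlog der1 mul0r.
Qed.
End Dlog.

(** * Integral combinations of finitely many formal symbols *)

Section IntegralCombinations.
Variables (F : fieldType) (n : nat).
Implicit Types (x : nat -> Fx F) (p q r e : nat -> int).

(** Exponent vectors are functions on the naturals, so that their sums, negatives and multiples stay
    closed terms that [vm_compute] evaluates at each index below [n]. *)
Definition lincomb (U : zmodType) (x : nat -> U) e : U :=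
  \sum_(i <- iota 0 n) x i *~ e i.

Definition indic (a : nat) : nat -> int := fun i => Posz (i == a).

Definition scale_exp (c : int) (e : nat -> int) : nat -> int := fun i => c * e i.

Lemma lincombD (U : zmodType) (x : nat -> U) p q :
  lincomb x (p \+ q) = lincomb x p + lincomb x q.
Proof. by rewrite /lincomb -big_split; apply: eq_bigr => i _ /=; rewrite mulrzDr. Qed.

Lemma lincombN (U : zmodType) (x : nat -> U) p : lincomb x (\- p) = - lincomb x p.
Proof. by rewrite /lincomb -sumrN; apply: eq_bigr => i _ /=; rewrite mulrNz. Qed.

Lemma lincombMz (U : zmodType) (x : nat -> U) p (c : int) :
  lincomb x (scale_exp c p) = lincomb x p *~ c.
Proof.
by rewrite /lincomb mulrz_suml; apply: eq_bigr => i _; rewrite /scale_exp mulrC mulrzA.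
Qed.

Lemma lincomb_indic (U : zmodType) (x : nat -> U) a :
  (a < n)%N -> lincomb x (indic a) = x a.
Proof.
move=> an; rewrite /lincomb (bigD1_seq a) ?iota_uniq ?mem_iota //= /indic eqxx big1 ?addr0 //.
by move=> i /negbTE ->; rewrite mulr0z.
Qed.

(** The row and the column of the head cancel entry by entry; induction does the rest. The diagonal
    has its own hypothesis because the other one only gives [g j j + g j j = 0] there, which would
    leave 2-torsion. *)
Lemma sum_alternating (U : zmodType) (s : seq nat) (g : nat -> nat -> U) :
  {in s, forall j, g j j = 0} -> {in s &, forall j k, g j k + g k j = 0} ->
  \sum_(j <- s) \sum_(k <- s) g j k = 0.
Proof.
elim: s => [|a s IH] gjj gjk; first by rewrite big_nil.
rewrite !big_cons gjj ?mem_head // add0r.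
under [X in _ + X]eq_bigr do rewrite big_cons.
rewrite big_split /= IH; first last.
- by move=> j k js ks; apply: gjk; rewrite inE ?js ?ks orbT.
- by move=> j js; apply: gjj; rewrite inE js orbT.
rewrite addr0 -big_split big_seq big1 // => k ks /=.
by apply: gjk; rewrite inE ?eqxx ?ks ?orbT.
Qed.

Definition wedge_coef (L : seq ((nat -> int) * (nat -> int))) (j k : nat) : int :=
  foldr (fun t c => t.1 j * t.2 k + c) 0 L.

Lemma sum_wedgeE x L :
  \sum_(t <- L) (lincomb x t.1 ∧ lincomb x t.2) =
  \sum_(j <- iota 0 n) \sum_(k <- iota 0 n) (x j ∧ x k) *~ wedge_coef L j k.
Proof.
elim: L => [|[q r] L IH].
  by rewrite big_nil big1 // => j _; rewrite big1.
rewrite big_cons IH /lincomb wedge_suml -big_split; apply: eq_bigr => j _.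
rewrite wedge_sumr -big_split; apply: eq_bigr => k _ /=.
by rewrite wedgeMzl wedgeMzr mulrzDr mulrzA mulrzAC.
Qed.

(* Decision procedure for identities in /\^2 F^x that hold formally in the x i. *)
Lemma sum_wedge_eq0 x L :
  all (fun j => all (fun k => wedge_coef L j k == wedge_coef L k j) (iota 0 n))
    (iota 0 n) ->
  \sum_(t <- L) (lincomb x t.1 ∧ lincomb x t.2) = 0.
Proof.
move=> /allP symL; rewrite sum_wedgeE; apply: sum_alternating => [j _|j k js ks].
  by rewrite wedgexx mul0rz.
by rewrite (eqP (allP (symL j js) k ks)) -mulrzDl (wedgeC (x j)) subrr mul0rz.
Qed.

(* The element of F ⊗ /\^2 F^x whose three slots are the Dlog, resp. the class,
   of the monomials in the v i with exponents t.1.1, t.1.2, t.2. *)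
Definition trilog (D : F -> F) (v : nat -> F)
    (t : (nat -> int) * (nat -> int) * (nat -> int)) : tensor F^o (Fx_wedge2 F) :=
  (lincomb (dlog D \o v) t.1.1 : F^o) ⊗
    (lincomb (@ux F \o v) t.1.2 ∧ lincomb (@ux F \o v) t.2).

Lemma trilogZ D v (c : int) p q r :
  trilog D v (scale_exp c p, q, r) = c%:~R *: trilog D v (p, q, r).
Proof. by rewrite /trilog tensZl /= lincombMz scaler_int. Qed.

Lemma trilogN D v p q r : trilog D v (scale_exp (-1) p, q, r) = - trilog D v (p, q, r).
Proof. by rewrite trilogZ mulrN1z scaleN1r. Qed.

(** Expanding the first slot alone leaves, for each [i], [dlog D (v i)] tensored with a sum of
    wedges weighted by the exponents [t.1.1 i]. Each of these sums vanishes by [sum_wedge_eq0]. *)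
Lemma sum_trilog_eq0 D v L :
  all (fun i => all (fun j => all (fun k =>
      let M := [seq (scale_exp (t.1.1 i) t.1.2, t.2) | t <- L] in
      wedge_coef M j k == wedge_coef M k j)
    (iota 0 n)) (iota 0 n)) (iota 0 n) ->
  \sum_(t <- L) trilog D v t = 0.
Proof.
move=> /allP symL; rewrite /trilog.
under eq_bigr => t _ do rewrite {1}/lincomb tens_suml.
rewrite exchange_big big_seq big1 // => i /symL {}symL /=.
(* The integer weight crosses the tensor sign and is absorbed into the first factor of the wedge. *)
under eq_bigr => t _ do rewrite tensMzl -tensMzr -wedgeMzl -lincombMz.
have := @sum_wedge_eq0 (@ux F \o v) _ symL; rewrite big_map => eq0.
by rewrite -tens_sumr eq0 tens0r.
Qed.

End IntegralCombinations.

Section Monomials.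
Variables (F : fieldType) (D : F -> F) (hD : derivation D) (n : nat) (v : nat -> F).

(** As [Fx] is written additively, for nonzero [v i] the second clause says that [x] is the product
    of the powers [v i ^ e i]; the third carries the same exponents over to Dlog. *)
Definition is_monomial (x : F) (e : nat -> int) : Prop :=
  [/\ x != 0, ux x = lincomb n (@ux F \o v) e & dlog D x = lincomb n (dlog D \o v) e].

Lemma is_monomialM x y p q :
  is_monomial x p -> is_monomial y q -> is_monomial (x * y) (p \+ q).
Proof.
move=> [x0 ux_x dx] [y0 ux_y dy]; split; first by rewrite mulf_neq0.
  by rewrite uxM // ux_x ux_y lincombD.
by rewrite dlogM // dx dy lincombD.
Qed.

Lemma is_monomialV x p : is_monomial x p -> is_monomial x^-1 (\- p).
Proof.
move=> [x0 ux_x dx]; split; first by rewrite invr_neq0.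
  by rewrite uxV // ux_x lincombN.
by rewrite dlogV // dx lincombN.
Qed.

Lemma is_monomial_var a : (a < n)%N -> v a != 0 -> is_monomial (v a) (indic a).
Proof. by move=> an va0; split; rewrite // lincomb_indic. Qed.

End Monomials.

(** * The maps delta2 and partialD *)

Lemma enum_I5 : enum 'I_5 = [seq inord i | i <- iota 0 5].
Proof.
apply: (inj_map val_inj); rewrite val_enum_ord -map_comp -[LHS]map_id.
by apply/eq_in_map => i; rewrite mem_iota /= => i5; rewrite inordK.
Qed.

(** [bump i k] is the index of the [k]-th survivor. Passing to naturals lets the deletion be
    computed for each of the five values of [i]. *)
Lemma omit1_I5 (T : Type) (x : 'I_5 -> T) (i : nat) : (i < 5)%N ->
  omit (pred1 (inord i)) x = [seq x (inord (bump i k)) | k <- iota 0 4].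
Proof.
move=> i5; rewrite /omit enum_I5 filter_map -map_comp (map_comp (x \o inord) (bump i)).
congr map; transitivity [seq k <- iota 0 5 | k != i].
  apply: eq_in_filter => k; rewrite mem_iota /= => k5.
  by rewrite -val_eqE /= !inordK.
by case: i i5 => [|[|[|[|[|]]]]].
Qed.

(** * Cross-ratios on the projective line and the five-term relation *)

Section CrossRatio.
Variable F : fieldType.
Implicit Types a b c d : P1 F.

Lemma pdiff_neq0 a b : a != b -> pdiff a b != 0.
Proof.
case: a b => [a|] [b|] //=; rewrite ?oppr_eq0 ?oner_neq0 // => ab.
by rewrite subr_eq0; apply: contraNneq ab => ->.
Qed.

Lemma pdiff_plucker a b c d :
  pdiff a c * pdiff b d - pdiff a d * pdiff b c = pdiff a b * pdiff c d.
Proof. by case: a b c d => [a|] [b|] [c|] [d|] /=; ring. Qed.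

(** The three-term relation makes [1 - r] a monomial in the differences [pdiff], like [r] itself, so
    that the wedge of the two can be expanded. *)
Lemma cross_ratioC a b c d : a != c -> b != d ->
  1 - cross_ratio a b c d = pdiff a b * pdiff c d / (pdiff a c * pdiff b d).
Proof.
move=> ac bd; have ac0 := pdiff_neq0 ac; have bd0 := pdiff_neq0 bd.
by rewrite -pdiff_plucker /cross_ratio; field; rewrite ac0 bd0.
Qed.
End CrossRatio.

Lemma on_FbbE (F : fieldType) (U : zmodType) (f : Fbb F -> U) (a : F)
    (ha : (a != 0) && (a != 1)) : on_Fbb f a = f (exist _ a ha).
Proof.
rewrite /on_Fbb; case: insubP => [u _ ua|]; last by rewrite ha.
by congr f; apply: val_inj.
Qed.

Section Delta2.
Variable F : fieldType.

Let delta2_gen (a : Fbb F) : Fx_wedge2 F := ux (1 - val a) ∧ ux (val a).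

Lemma delta2_cross_ratio (a b c d : P1 F) : a != b -> a != c -> a != d ->
  b != c -> b != d -> c != d ->
  zlift delta2_gen (on_Fbb (fun t => << t >>) (cross_ratio a b c d)) =
  (ux (pdiff a b) + ux (pdiff c d) - (ux (pdiff a c) + ux (pdiff b d))) ∧
  (ux (pdiff a d) + ux (pdiff b c) - (ux (pdiff a c) + ux (pdiff b d))).
Proof.
move=> ab ac ad bc bd cd.
have [ab0 ac0 ad0] := And3 (pdiff_neq0 ab) (pdiff_neq0 ac) (pdiff_neq0 ad).
have [bc0 bd0 cd0] := And3 (pdiff_neq0 bc) (pdiff_neq0 bd) (pdiff_neq0 cd).
(* Distinct points keep the cross-ratio away from 0 and 1, so the default value of [on_Fbb] does not
   occur. *)
have r0 : (cross_ratio a b c d != 0) && (cross_ratio a b c d != 1).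
  rewrite [_ == 1]eq_sym -[1 == _]subr_eq0 cross_ratioC //.
  by rewrite !(mulf_neq0, invr_neq0).
rewrite on_FbbE zliftU /delta2_gen /= cross_ratioC //.
by rewrite !uxf ?mulf_neq0 // !uxM.
Qed.

(** This is what makes [delta2] well defined. Deletion preserves the order of the points, so all
    five wedges expand in the symbols [ux (pdiff (y i) (y j))] with [i < j], no sign arises, and the
    alternating sum cancels formally. *)
Lemma delta2_gen_five_term x : five_term_rel x -> zlift delta2_gen x = 0.
Proof.
case=> {}x injx; pose y k := x (inord k).
have neqy i j : (i < 5)%N -> (j < 5)%N -> i != j -> y i != y j.
  by move=> i5 j5; apply: contraNneq => /injx /(congr1 val); rewrite /= !inordK // => ->.
have crE i : (i < 5)%N -> cross_ratio_omit x (inord i) =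
    cross_ratio (y (bump i 0)) (y (bump i 1)) (y (bump i 2)) (y (bump i 3)).
  by move=> i5; rewrite /cross_ratio_omit omit1_I5.
have -> : \sum_(i < 5) (-1) ^+ i *: on_Fbb (fun a => << a >>) (cross_ratio_omit x i) =
    \sum_(i <- iota 0 5) on_Fbb (fun a : Fbb F => << a >> : {freeg (Fbb F)})
       (cross_ratio_omit x (inord i)) *~ (-1) ^+ i.
  rewrite -[iota 0 5]/(index_iota 0 5) big_mkord; apply: eq_bigr => i _.
  by rewrite inord_val -scaler_int intz.
rewrite !big_cons big_nil !crE // addr0 !raddfD /= !raddfMz /=.
rewrite !delta2_cross_ratio ?neqy //.
(* The pair [(i, j)] is encoded as [5 * i + j], whence 25 formal variables. *)
pose X n := ux (pdiff (y (n %/ 5)%N) (y (n %% 5)%N)).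
have eE i j : (i < 5)%N -> (j < 5)%N ->
    ux (pdiff (y i) (y j)) = lincomb 25 X (indic (i * 5 + j)).
  move=> i5 j5; rewrite lincomb_indic /X ?divnMDl ?modnMDl ?modn_small ?divn_small ?addn0 //.
  by rewrite (@leq_trans (i * 5 + 5)%N) ?ltn_add2l // -mulSnr (leq_mul2r 5 _ 5).
rewrite !eE // -!wedgeMzl -!(lincombN, lincombD, lincombMz).
(* The exponent vectors are left open and filled in by unification with the five wedges of the
   goal. *)
refine (etrans _ (@sum_wedge_eq0 _ 25 X [:: (_, _); (_, _); (_, _); (_, _); (_, _)] _)).
  by rewrite 5!big_cons big_nil addr0; reflexivity.
by vm_compute.
Qed.

Lemma delta2E (a : Fbb F) : delta2 (B2_cl a) = ux (1 - val a) ∧ ux (val a).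
Proof. by rewrite /delta2 /B2_cl (zdescendE delta2_gen_five_term) /= zliftU. Qed.

Lemma delta2_additive : zmod_morphism (@delta2 F).
Proof. exact/zdescend_additive/delta2_gen_five_term. Qed.
HB.instance Definition _ :=
  GRing.isZmodMorphism.Build (B2 F) (Fx_wedge2 F) (@delta2 F) delta2_additive.
End Delta2.

(** * Linearity of [partialD] and its values on generators *)

Section LinearLifts.
Variables (R : nzRingType) (A : lmodType R) (B : zmodType) (U : lmodType R).

Lemma tensor_scalable (f : {additive tensor A B -> U}) :
  (forall c x y, f ((c *: x) ⊗ y) = c *: f (x ⊗ y)) ->
  forall c q, f (c *: q) = c *: f q.
Proof.
move=> fZ c q; apply: (tensor_ext (f := f \o *:%R c) (g := *:%R c \o f)) => x y /=.
by rewrite tensZl fZ.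
Qed.

Lemma tlift_linear (f : A -> B -> U) :
  (forall x x' y, f (x + x') y = f x y + f x' y) ->
  (forall x y y', f x (y + y') = f x y + f x y') ->
  (forall c x y, f (c *: x) y = c *: f x y) -> linear (tlift f).
Proof.
move=> fDl fDr fZ c p q.
pose g : {additive tensor A B -> U} :=
  HB.pack (tlift f) (GRing.isZmodMorphism.Build _ _ (tlift f) (tlift_additive fDl fDr)).
have gZ := @tensor_scalable g; rewrite -[tlift f]/(g : _ -> _) raddfD gZ //.
by move=> k x y; rewrite /= !tliftE.
Qed.

Lemma add_pair_linear (A' : lmodType R) (f : A -> U) (g : A' -> U) :
  linear f -> linear g -> linear (fun p : A * A' => f p.1 + g p.2).
Proof. by move=> fL gL c [p p'] [q q'] /=; rewrite fL gL scalerDr addrACA. Qed.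

Lemma add_pair_additive (M M' W : zmodType) (f : M -> W) (g : M' -> W) :
  zmod_morphism f -> zmod_morphism g ->
  zmod_morphism (fun p : M * M' => f p.1 + g p.2).
Proof. by move=> fB gB [p p'] [q q'] /=; rewrite fB gB opprD addrACA. Qed.
End LinearLifts.

Section PartialD.
Variables (F : fieldType) (D : F -> F) (hD : derivation D).

Lemma wedge_right_tens (b u : Fx F) (x : F^o) : wedge_right b (x ⊗ u) = x ⊗ (u ∧ b).
Proof. by rewrite /wedge_right tliftE // => *; rewrite ?tensDl // wedgeDl tensDr. Qed.

Lemma wedge_right_linear (b : Fx F) : linear (@wedge_right F b).
Proof.
by apply: tlift_linear => *; rewrite ?tensZl ?tensDl // wedgeDl tensDr.
Qed.
HB.instance Definition _ b := GRing.isLinear.Build F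
  (tensor F^o (Fx F)) (tensor F^o (Fx_wedge2 F)) _ (@wedge_right F b) (wedge_right_linear b).

Lemma wedge_rightD (b b' : Fx F) q :
  wedge_right (b + b') q = wedge_right b q + wedge_right b' q.
Proof.
apply: (tensor_ext (f := @wedge_right F (b + b')) (g := wedge_right b \+ wedge_right b')).
by move=> x u /=; rewrite !wedge_right_tens wedgeDr tensDr.
Qed.

Let beta2D_logZ c (q : beta2D D) : beta2D_log (c *: q) = c *: beta2D_log q.
Proof. exact: coim_mapZ. Qed.

Let wedgeq (q : beta2D D) (b : Fx F) : tensor F^o (Fx_wedge2 F) :=
  - wedge_right b (beta2D_log q).
Let tensd (x : F^o) (y : B2 F) : tensor F^o (Fx_wedge2 F) := x ⊗ delta2 y.

Let wedgeqDl p q b : wedgeq (p + q) b = wedgeq p b + wedgeq q b.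
Proof. by rewrite /wedgeq !raddfD. Qed.
Let wedgeqDr q b b' : wedgeq q (b + b') = wedgeq q b + wedgeq q b'.
Proof. by rewrite /wedgeq wedge_rightD opprD. Qed.
Let wedgeqZ c q b : wedgeq (c *: q) b = c *: wedgeq q b.
Proof. by rewrite /wedgeq beta2D_logZ linearZ -scalerN. Qed.
Let tensdDl x x' y : tensd (x + x') y = tensd x y + tensd x' y.
Proof. exact: tensDl. Qed.
Let tensdDr x y y' : tensd x (y + y') = tensd x y + tensd x y'.
Proof. by rewrite /tensd raddfD tensDr. Qed.
Let tensdZ c x y : tensd (c *: x) y = c *: tensd x y.
Proof. by rewrite /tensd tensZl. Qed.

Lemma partialD_linear : linear (@partialD F D).
Proof.
exact (add_pair_linear (tlift_linear wedgeqDl wedgeqDr wedgeqZ)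
                       (tlift_linear tensdDl tensdDr tensdZ)).
Qed.
Lemma partialD_additive : zmod_morphism (@partialD F D).
Proof.
exact (add_pair_additive (tlift_additive wedgeqDl wedgeqDr)
                         (tlift_additive tensdDl tensdDr)).
Qed.

(** The factor D(a)/(a(1-a)) turns the coefficient a into D(a)/(1-a) = -Dlog(1-a), and the
    coefficient 1-a into Dlog(a). *)
Lemma beta2D_log_dbr (a : Fbb F) :
  beta2D_log (dbr D a) = (dlog D (val a) : F^o) ⊗ ux (1 - val a)
    - (dlog D (1 - val a) : F^o) ⊗ ux (val a).
Proof.
case/andP: (valP a) => a0 a1; have a1' : 1 - val a != 0 by rewrite subr_eq0 eq_sym.
rewrite /beta2D_log /= /dbr_val coim_mapZ coim_mapE /= /beta2_map liftU scale1r.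
rewrite scalerDr !tensZl addrC -tensNl; congr (_ ⊗ _ + _ ⊗ _).
  by rewrite /dlog /GRing.scale /=; field; rewrite a0 a1'.
by rewrite /dlog (derD hD) (derN hD) (der1 hD) /GRing.scale /=; field; rewrite a0 a1'.
Qed.

(** Confirms that [partialD], defined through the injection [beta2D_log], is the map prescribed on
    generators. *)
Lemma partialDE (a a' : Fbb F) (b : Fx F) (x : F^o) :
  partialD (dbr D a ⊗ b, x ⊗ B2_cl a') =
    (dlog D (1 - val a) : F^o) ⊗ (ux (val a) ∧ b)
    - (dlog D (val a) : F^o) ⊗ (ux (1 - val a) ∧ b)
    + x ⊗ (ux (1 - val a') ∧ ux (val a')).
Proof.
have -> : partialD (dbr D a ⊗ b, x ⊗ B2_cl a') =
    tlift wedgeq (dbr D a ⊗ b) + tlift tensd (x ⊗ B2_cl a') by [].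
rewrite (tliftE wedgeqDl wedgeqDr) (tliftE tensdDl tensdDr) /tensd delta2E.
by rewrite /wedgeq beta2D_log_dbr raddfB /= !wedge_right_tens opprB.
Qed.
End PartialD.

(** * Volume forms and generic tuples *)

Section VolumeForm.
Variables (F : fieldType) (V : vectType F) (w : V -> V -> V -> F).
Hypothesis hw : volume_form w.
Implicit Types x y z a b c d e : V.

Lemma vol_D1 x x' y z : w (x + x') y z = w x y z + w x' y z.
Proof. by rewrite -[x in LHS]scale1r (vol_lin1 hw) mul1r. Qed.
Lemma vol_D2 x y y' z : w x (y + y') z = w x y z + w x y' z.
Proof. by rewrite -[y in LHS]scale1r (vol_lin2 hw) mul1r. Qed.
Lemma vol_D3 x y z z' : w x y (z + z') = w x y z + w x y z'.
Proof. by rewrite -[z in LHS]scale1r (vol_lin3 hw) mul1r. Qed.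
Lemma vol_01 y z : w 0 y z = 0.
Proof. by apply: (addrI (w 0 y z)); rewrite -vol_D1 !addr0. Qed.
Lemma vol_02 x z : w x 0 z = 0.
Proof. by apply: (addrI (w x 0 z)); rewrite -vol_D2 !addr0. Qed.
Lemma vol_03 x y : w x y 0 = 0.
Proof. by apply: (addrI (w x y 0)); rewrite -vol_D3 !addr0. Qed.
Lemma vol_Z1 k x y z : w (k *: x) y z = k * w x y z.
Proof. by rewrite -[k *: x]addr0 (vol_lin1 hw) vol_01 addr0. Qed.
Lemma vol_Z2 k x y z : w x (k *: y) z = k * w x y z.
Proof. by rewrite -[k *: y]addr0 (vol_lin2 hw) vol_02 addr0. Qed.
Lemma vol_Z3 k x y z : w x y (k *: z) = k * w x y z.
Proof. by rewrite -[k *: z]addr0 (vol_lin3 hw) vol_03 addr0. Qed.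

Lemma vol_swap12 x y z : w y x z = - w x y z.
Proof.
apply/eqP; rewrite -addr_eq0; apply/eqP; have := vol_alt12 hw (y + x) z.
by rewrite vol_D1 !vol_D2 !(vol_alt12 hw) add0r addr0.
Qed.

Lemma vol_swap23 x y z : w x z y = - w x y z.
Proof.
apply/eqP; rewrite -addr_eq0; apply/eqP; have := vol_alt23 hw x (z + y).
by rewrite vol_D2 !vol_D3 !(vol_alt23 hw) add0r addr0.
Qed.

Lemma vol_rot x y z : w z x y = w x y z.
Proof. by rewrite vol_swap12 vol_swap23 opprK. Qed.

Definition vol_linE := (vol_D1, vol_D2, vol_D3, vol_Z1, vol_Z2, vol_Z3).
Definition vol_altE := (vol_alt12 hw, vol_alt23 hw, vol_alt13 hw).

Hypothesis hV : \dim {:V} = 3%N.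

Lemma free3_coord x y z a : free [:: x; y; z] ->
  exists k0 k1 k2, a = k0 *: x + k1 *: y + k2 *: z.
Proof.
move=> fX; have bX : basis_of fullv [tuple x; y; z].
  by rewrite basisEfree fX subvf hV.
have := coord_basis bX (memvf a); rewrite !big_ord_recl big_ord0 addr0 !addrA /=.
by move=> ->; do 3!eexists.
Qed.

(** Of the 27 terms of the trilinear expansion, alternation kills 21; the other six are brought to
    [w x y z] by transpositions and rotations and form the determinant. *)
Lemma vol_coord x y z p0 p1 p2 q0 q1 q2 r0 r1 r2 :
  w (p0 *: x + p1 *: y + p2 *: z) (q0 *: x + q1 *: y + q2 *: z)
    (r0 *: x + r1 *: y + r2 *: z) =
  (p0 * (q1 * r2 - q2 * r1) - p1 * (q0 * r2 - q2 * r0)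
   + p2 * (q0 * r1 - q1 * r0)) * w x y z.
Proof.
have yzx : w y z x = w x y z by rewrite -(vol_rot y z x).
rewrite !vol_linE !vol_altE (vol_swap12 y z x) yzx (vol_rot x y z).
rewrite (vol_swap12 x y z) (vol_swap23 x y z); ring.
Qed.

Lemma vol_free x y z : free [:: x; y; z] -> w x y z != 0.
Proof.
move=> fX; have [a [b [c]]] := vol_neq0 hw; apply: contraNneq => w0.
have [p0 [p1 [p2 ->]]] := free3_coord a fX.
have [q0 [q1 [q2 ->]]] := free3_coord b fX.
have [r0 [r1 [r2 ->]]] := free3_coord c fX.
by rewrite vol_coord w0 mulr0.
Qed.

(** For fixed [a], [w a] is an area form on the plane V/a, and this is its three-term relation. In
    the basis [a], [b], [c] it is a polynomial identity in the coordinates of [d] and [e]. *)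
Lemma vol_plucker a b c d e : free [:: a; b; c] ->
  w a b d * w a c e - w a b e * w a c d = w a b c * w a d e.
Proof.
move=> fX; have [q0 [q1 [q2 ->]]] := free3_coord d fX.
have [r0 [r1 [r2 ->]]] := free3_coord e fX.
rewrite !vol_linE !vol_altE (vol_swap23 a b c); ring.
Qed.

Lemma proj_cross_ratioC a b c d e : free [:: a; b; c] ->
  w a b d != 0 -> w a c e != 0 ->
  1 - proj_cross_ratio w a b c d e = (w a b c * w a d e) / (w a b d * w a c e).
Proof.
move=> fX abd ace; rewrite -vol_plucker // /proj_cross_ratio; field.
by rewrite abd ace.
Qed.
End VolumeForm.

(** By [vol_coord] each form is the coordinate determinant times its value on a basis; [k] is the
    ratio of the two values. *)
Lemma vol_proportional (F : fieldType) (V : vectType F) (w w' : V -> V -> V -> F) :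
  \dim {:V} = 3%N -> volume_form w -> volume_form w' ->
  exists k, forall a b c, w' a b c = k * w a b c.
Proof.
move=> hV hw hw'; have := vbasisP {:V}; move: (vbasis _); rewrite hV => X bX.
have [x [y [z defX]]] : exists x y z, X = [:: x; y; z] :> seq V.
  by case: X {bX} => [[|x [|y [|z []]]]] //= _; exists x, y, z.
have fX : free [:: x; y; z] by rewrite -defX; exact: basis_free bX.
have w0 := vol_free hw hV fX.
exists (w' x y z / w x y z) => a b c.
have [p0 [p1 [p2 ->]]] := free3_coord hV a fX.
have [q0 [q1 [q2 ->]]] := free3_coord hV b fX.
have [r0 [r1 [r2 ->]]] := free3_coord hV c fX.
by rewrite !vol_coord //; field.
Qed.

(** * Determinants of generic tuples and the action of GL(V) *)

Section Generic.
Variables (F : fieldType) (V : vectType F) (w : V -> V -> V -> F).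
Hypotheses (hV : \dim {:V} = 3%N) (hw : volume_form w).

Lemma generic_free3 m (l : {ffun 'I_m -> V}) (a b c : 'I_m) :
  generic l -> uniq [:: a; b; c] -> free [:: l a; l b; l c].
Proof.
move=> /forallP gl abc; have := gl [set x in [:: a; b; c]].
rewrite cardsE (leq_trans (card_size _)) //=.
rewrite -(@perm_free _ _ [seq l i | i <- [:: a; b; c]]) //.
apply/perm_map/uniq_perm; [exact: abc | exact: enum_uniq | move=> x].
by rewrite mem_enum in_set.
Qed.

Lemma Delta_omit_neq0 m (l : {ffun 'I_m -> V}) (A : pred 'I_m) :
  generic l -> (3 <= #|predC A|)%N -> Delta_omit w A l != 0.
Proof.
move=> gl; rewrite /Delta_omit /omit cardE /enum_mem.
have -> : [seq x <- Finite.enum 'I_m | x \in predC A] = [seq k <- enum 'I_m | ~~ A k].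
  by rewrite enumT; apply: eq_filter => x; rewrite inE.
have := filter_uniq (fun k => ~~ A k) (enum_uniq 'I_m).
case: filter => [|a [|b [|c s]]] //=; rewrite !inE !negb_or => /and4P[].
move=> /and3P[ab ac _] /andP[bc _] _ _ _; apply: (vol_free hw hV).
by apply: generic_free3; rewrite //= !inE negb_or ab ac bc.
Qed.

Lemma Delta_omit_comp m (A : pred 'I_m) (g : 'End(V)) (l : {ffun 'I_m -> V}) l' :
  (forall i, l' i = g (l i)) ->
  Delta_omit w A l' = Delta_omit (fun x y z => w (g x) (g y) (g z)) A l.
Proof.
(* The default 0 of [nth] is harmless, since [g] maps 0 to 0. *)
move=> l'E; have nthE k : (omit A l')`_k = g (omit A l)`_k.
  rewrite /omit; elim: [seq _ <- _ | _] k => [|x s IH] [|k] //=; rewrite ?linear0 //.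
by rewrite /Delta_omit !nthE.
Qed.

(** [k] is the determinant of [g], obtained by comparing [w] with its pullback, which is again a
    volume form because [g] is invertible. *)
Lemma vol_comp_proportional (g : 'End(V)) : lker g == 0%VS ->
  exists2 k, k != 0 & forall x y z, w (g x) (g y) (g z) = k * w x y z.
Proof.
move=> g0; have gK := lker0_lfunVK g0.
have [a [b [c wabc]]] := vol_neq0 hw.
have hwg : volume_form (fun x y z => w (g x) (g y) (g z)).
  split=> *; rewrite ?linearP ?(vol_lin1 hw, vol_lin2 hw, vol_lin3 hw) ?vol_altE //.
  by exists (g^-1%VF a), (g^-1%VF b), (g^-1%VF c); rewrite !gK.
have [k kE] := vol_proportional hV hw hwg; exists k => //.
have [x [y [z]]] := vol_neq0 hwg; rewrite kE.
by apply: contraNneq => ->; rewrite mul0r.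
Qed.
End Generic.

(** * The map tau0 and the five-point computation *)

Section Tau0.
Variables (F : fieldType) (D : F -> F) (hD : derivation D) (V : vectType F).
Variable (w : V -> V -> V -> F).
Hypotheses (hV : \dim {:V} = 3%N) (hw : volume_form w).

Lemma tau0_genE (l : gtuple V 4) (a : nat -> F) :
  (forall i : 'I_4, Delta_omit w (pred1 i) (val l) = a i) ->
  tau0_gen D w l = \sum_(i <- iota 0 4) (-1) ^+ i *:
    ((dlog D (a i) : F^o) ⊗ (ux (a ((i + 1) %% 4)%N / a ((i + 2) %% 4)%N) ∧
                             ux (a ((i + 3) %% 4)%N / a ((i + 2) %% 4)%N))).
Proof.
move=> aE; rewrite -[iota 0 4]/(index_iota 0 4) big_mkord; apply: eq_bigr => i _.
by rewrite !aE.
Qed.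

(** All four determinants are multiplied by the same [k]. The ratios do not change, and the only new
    contribution is Dlog(k) tensored with an alternating sum of wedges that vanishes formally in the
    four determinants. *)
Lemma tau0_gen_GL (g : 'End(V)) (l l' : gtuple V 4) :
  lker g == 0%VS -> (forall i, val l' i = g (val l i)) ->
  tau0_gen D w l' = tau0_gen D w l.
Proof.
move=> g0 l'E; have [k k0 kE] := vol_comp_proportional hV hw g0.
pose a n := Delta_omit w (pred1 (inord n : 'I_4)) (val l).
have a0 n : a n != 0.
  by apply: (Delta_omit_neq0 hV hw (valP l)); rewrite cardC1 card_ord.
have aE (i : 'I_4) : Delta_omit w (pred1 i) (val l) = a i by rewrite /a inord_val.
have a'E (i : 'I_4) : Delta_omit w (pred1 i) (val l') = k * a i.
  by rewrite (Delta_omit_comp w _ l'E) -aE /Delta_omit kE.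
rewrite (tau0_genE aE) (tau0_genE (a := fun i => k * a i) a'E).
have ratio m n : (k * a m) / (k * a n) = a m / a n.
  by field; rewrite k0 a0.
under eq_bigr do rewrite !ratio (dlogM hD) // tensDl scalerDr.
rewrite big_split /= -[RHS]add0r; congr (_ + _).
pose X n := ux (a n).
have XE n : (n < 4)%N -> ux (a n) = lincomb 4 X (indic n).
  by move=> n4; rewrite lincomb_indic.
rewrite !big_cons big_nil addr0 /= !uxf // !XE //.
rewrite -(signr_odd _ 2) -(signr_odd _ 3) /= !expr0 !expr1 !scale1r !scaleN1r.
rewrite -!(lincombN, lincombD) -!tensNr -!wedgeNl -!lincombN -!tensDr.
rewrite -[RHS](tens0r _ (dlog D k : F^o)); congr (_ ⊗ _).
refine (etrans _ (@sum_wedge_eq0 _ 4 X [:: (_, _); (_, _); (_, _); (_, _)] _)).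
  by rewrite 4!big_cons big_nil addr0; reflexivity.
by vm_compute.
Qed.

Lemma tau0_rel x : GL_rel x -> zlift (tau0_gen D w) x = 0.
Proof.
by case=> g l l' g0 l'E; rewrite raddfB /= !zliftU (tau0_gen_GL g0 l'E) subrr.
Qed.

Lemma tau0_cl l : tau0 D w (cfg_cl l) = tau0_gen D w l.
Proof. by rewrite /tau0 /cfg_cl (zdescendE tau0_rel) /= zliftU. Qed.

Lemma tau0_additive : zmod_morphism (@tau0 F V D w).
Proof. exact/zdescend_additive/tau0_rel. Qed.
End Tau0.

(** * The ten determinants of a generic 5-tuple *)

Section FivePoints.
Variables (F : fieldType) (D : F -> F) (hD : derivation D) (V : vectType F).
Variable (w : V -> V -> V -> F).
Hypotheses (hV : \dim {:V} = 3%N) (hw : volume_form w).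
Variables (l : gtuple V 5).

Definition pairs5 : seq (nat * nat) :=
  [:: (0, 1); (0, 2); (0, 3); (0, 4); (1, 2); (1, 3); (1, 4); (2, 3); (2, 4); (3, 4)]%N.

(** Deleting two vectors does not depend on the order of their indices, which are therefore sorted
    before the lookup. *)
Definition pair_index (i j : nat) : nat := index (minn i j, maxn i j) pairs5.

Definition Delta_pair (n : nat) : F :=
  let p := nth (0, 1)%N pairs5 n in
  Delta_omit w (pred2 (inord p.1) (inord p.2)) (val l).

Lemma pair_index_lt i j : (i < 5)%N -> (j < 5)%N -> i != j -> (pair_index i j < 10)%N.
Proof. by move: i j => [|[|[|[|[|]]]]] [|[|[|[|[|]]]]]. Qed.

Lemma Delta_pairE i j : (i < 5)%N -> (j < 5)%N -> i != j ->
  Delta_pair (pair_index i j) = Delta_omit w (pred2 (inord i) (inord j)) (val l).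
Proof.
move=> i5 j5 ij; rewrite /Delta_pair nth_index; last first.
  by rewrite -index_mem; exact: pair_index_lt.
have [_|_] := leqP i j => //=; rewrite /Delta_omit /omit.
by rewrite (@eq_filter _ _ (fun k => ~~ pred2 (inord i) (inord j) k)) // => k /=; rewrite orbC.
Qed.

Lemma Delta_pair_neq0 i j : (i < 5)%N -> (j < 5)%N -> i != j ->
  Delta_pair (pair_index i j) != 0.
Proof.
move=> i5 j5 ij; rewrite Delta_pairE //; apply: (Delta_omit_neq0 hV hw (valP l)).
have := cardC (pred2 (inord i : 'I_5) (inord j)); rewrite card2 card_ord.
by rewrite -val_eqE /= !inordK // ij => /(@addnI 2 _ 3)/esym/eq_leq.
Qed.

Let L (k : nat) : V := val l (inord k).

Lemma Delta_omit_pairE i j : (i < 5)%N -> (j < 5)%N ->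
  Delta_omit w (pred2 (inord i) (inord j)) (val l) =
  let s := [seq L k | k <- iota 0 5 & (k != i) && (k != j)] in w s`_0 s`_1 s`_2.
Proof.
move=> i5 j5; rewrite /Delta_omit /omit enum_I5 filter_map -map_comp.
rewrite (@eq_in_filter _ _ (fun k => (k != i) && (k != j))) // => k.
rewrite mem_iota /= => k5; by rewrite -!val_eqE /= !inordK // negb_or.
Qed.

Lemma free_L i j k : (i < 5)%N -> (j < 5)%N -> (k < 5)%N -> uniq [:: i; j; k] ->
  free [:: L i; L j; L k].
Proof.
move=> i5 j5 k5 ijk; apply: generic_free3 (valP l) _.
rewrite -(map_inj_uniq val_inj) /= !inordK //.
Qed.

(** The determinant of three vectors is named by the two that it omits: the one on [i], [a], [d] is
    that of the pair [b], [c], and so on. *)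
Lemma proj_cross_ratio_omitE i : (i < 5)%N ->
  let a := bump i 0 in let b := bump i 1 in let c := bump i 2 in let d := bump i 3 in
  let r := proj_cross_ratio_omit w (val l) (inord i) in
  r = Delta_pair (pair_index b c) * Delta_pair (pair_index a d)
      / (Delta_pair (pair_index b d) * Delta_pair (pair_index a c)) /\
  1 - r = Delta_pair (pair_index c d) * Delta_pair (pair_index a b)
      / (Delta_pair (pair_index b d) * Delta_pair (pair_index a c)).
Proof.
move=> i5 a b c d r.
have rE : r = proj_cross_ratio w (L i) (L a) (L b) (L c) (L d).
  by rewrite /r /proj_cross_ratio_omit omit1_I5.
have r1E : 1 - r = w (L i) (L a) (L b) * w (L i) (L c) (L d)
                   / (w (L i) (L a) (L c) * w (L i) (L b) (L d)).
  rewrite rE (proj_cross_ratioC hw hV) //; try apply: (vol_free hw hV);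
  by apply: free_L; rewrite /a /b /c /d; move: (i) i5 => [|[|[|[|[|]]]]].
rewrite r1E rE /proj_cross_ratio {r rE r1E}/a {}/b {}/c {}/d.
(* Only [L i] can be out of place: behind both other vectors, a rotation sorts the triple without
   sign; between them, [swap] costs a sign, and these signs cancel in the quotient. *)
have rot x y z : w (L z) (L x) (L y) = w (L x) (L y) (L z) by exact: vol_rot.
have swap x y z : w (L y) (L x) (L z) = - w (L x) (L y) (L z) by exact: vol_swap12.
by move: i i5 => [|[|[|[|[|//]]]]] _; rewrite !Delta_pairE // !Delta_omit_pairE //=;
  rewrite ?(rot 0 1 2, rot 0 1 3, rot 0 2 3, rot 1 2 3, rot 0 1 4, rot 0 2 4, rot 0 3 4,
    rot 1 2 4, rot 1 3 4, rot 2 3 4)%N;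
  rewrite ?(swap 0 1, swap 0 2, swap 0 3, swap 1 2, swap 1 3, swap 2 3)%N;
  rewrite ?(mulNr, mulrN, invrN, opprK).
Qed.
End FivePoints.

Lemma enum_I5_lift (i : 'I_5) :
  [seq k <- enum 'I_5 | k != i] = [seq fintype.lift i k | k <- enum 'I_4].
Proof.
apply: (inj_map val_inj); rewrite -map_comp (map_comp (bump i) val) val_enum_ord.
rewrite -(filter_map val (fun k => k != i :> nat)) val_enum_ord.
by case: i => [[|[|[|[|[|]]]]]].
Qed.

(** Identifies the determinants of the faces, which enter [tau0], with the Delta(^l_i, ^l_j) that
    enter [tau1]. *)
Lemma omit_del (F : fieldType) (V : vectType F) (l : {ffun 'I_5 -> V}) i k :
  omit (pred1 k) (del_val i l) = omit (pred2 i (fintype.lift i k)) l.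
Proof.
rewrite /omit -(eq_filter (a1 := predI (fun j => j != fintype.lift i k) (fun j => j != i))).
  rewrite filter_predI enum_I5_lift [in RHS]filter_map -[RHS]map_comp.
  rewrite [LHS](eq_map (g := l \o fintype.lift i)); last by move=> j; rewrite /= ffunE.
  by congr (map _ _); apply: eq_filter => j /=; rewrite (inj_eq lift_inj).
by move=> j /=; rewrite negb_or andbC.
Qed.

(** * The exponents of both composites and the finite verification *)

Definition pair_exp (i j : nat) : nat -> int := indic (pair_index i j).

(* The exponents, in the Delta_pair, of r(l_i | ...), of 1 - r(l_i | ...) and of
   the product of the Delta(^l_i, ^l_j); bump i k is the index of the k-th vector
   after deletion of l_i. *)
Definition ratio_exp i : nat -> int :=
  (pair_exp (bump i 1) (bump i 2) \+ pair_exp (bump i 0) (bump i 3)) \+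
  \- (pair_exp (bump i 1) (bump i 3) \+ pair_exp (bump i 0) (bump i 2)).

Definition coratio_exp i : nat -> int :=
  (pair_exp (bump i 2) (bump i 3) \+ pair_exp (bump i 0) (bump i 1)) \+
  \- (pair_exp (bump i 1) (bump i 3) \+ pair_exp (bump i 0) (bump i 2)).

Definition prod_exp i : nat -> int :=
  pair_exp i (bump i 0) \+ (pair_exp i (bump i 1) \+
    (pair_exp i (bump i 2) \+ pair_exp i (bump i 3))).

Definition tau0_exps i : seq ((nat -> int) * (nat -> int) * (nat -> int)) :=
  [seq (scale_exp ((-1) ^+ j) (pair_exp i (bump i j)),
        pair_exp i (bump i ((j + 1) %% 4)%N) \+ \- pair_exp i (bump i ((j + 2) %% 4)%N),
        pair_exp i (bump i ((j + 3) %% 4)%N) \+ \- pair_exp i (bump i ((j + 2) %% 4)%N))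
  | j <- iota 0 4].

Definition tau1_exps i : seq ((nat -> int) * (nat -> int) * (nat -> int)) :=
  [:: (coratio_exp i, ratio_exp i, prod_exp i);
      (scale_exp (-1) (ratio_exp i), coratio_exp i, prod_exp i);
      (prod_exp i, coratio_exp i, ratio_exp i)].

(** The terms of three times the difference of the two composites. The factor -1/3 of [tau1] is why
    its terms enter with a plus sign. *)
Definition square_exps : seq ((nat -> int) * (nat -> int) * (nat -> int)) :=
  flatten [seq [seq (scale_exp (3 * (-1) ^+ i) t.1.1, t.1.2, t.2) | t <- tau0_exps i] ++
               [seq (scale_exp ((-1) ^+ i) t.1.1, t.1.2, t.2) | t <- tau1_exps i]
          | i <- iota 0 5].

(** The combinatorial core: a computation with integers, independent of the field and of the tuple,
    in the form required by [sum_trilog_eq0]. *)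
Lemma square_exps_symmetric :
  all (fun i => all (fun j => all (fun k =>
      let M := [seq (scale_exp (t.1.1 i) t.1.2, t.2) | t <- square_exps] in
      wedge_coef M j k == wedge_coef M k j)
    (iota 0 10)) (iota 0 10)) (iota 0 10).
Proof. by vm_compute. Qed.

Lemma linear_scale_sum (R : nzRingType) (A B : lmodType R) (f : A -> B) (c : R)
    (n : nat) (k : 'I_n -> R) (x : 'I_n -> A) : linear f ->
  f (c *: \sum_(i < n) k i *: x i) = c *: \sum_(i < n) k i *: f (x i).
Proof.
move=> fL; pose g : {linear A -> B} := HB.pack f (GRing.isLinear.Build R A B _ f fL).
rewrite -[f]/(g : _ -> _) linearZ linear_sum; congr (_ *: _).
by apply: eq_bigr => i _; rewrite linearZ.
Qed.

Section ZLiftTheory.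
Variables (T : choiceType) (U W : zmodType).

Lemma eq_zlift (g g' : T -> U) : g =1 g' -> zlift g =1 zlift g'.
Proof. by move=> gg'; apply: zfree_ext => t; rewrite /= !zliftU. Qed.

Lemma zlift_comp (f : U -> W) (g : T -> U) (y : {freeg T}) :
  zmod_morphism f -> f (zlift g y) = zlift (f \o g) y.
Proof.
move=> fB.
pose h : {additive U -> W} := HB.pack f (GRing.isZmodMorphism.Build U W f fB).
by rewrite -(@zfree_ext _ _ (h \o zlift g) (zlift (f \o g))) // => t /=; rewrite !zliftU.
Qed.
End ZLiftTheory.

(** * Both composites on a generic 5-tuple *)

Section Faces.
Variables (F : fieldType) (D : F -> F) (hD : derivation D) (V : vectType F).
Variable (w : V -> V -> V -> F).
Hypotheses (hV : \dim {:V} = 3%N) (hw : volume_form w).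
Variables (l : gtuple V 5).

Let v := Delta_pair w l.
Let mono := is_monomial D 10 v.

Let mono_pair i j : (i < 5)%N -> (j < 5)%N -> i != j ->
  mono (v (pair_index i j)) (pair_exp i j).
Proof.
by move=> *; apply: is_monomial_var; [exact: pair_index_lt | exact: Delta_pair_neq0].
Qed.

Let monoM x y p q : mono x p -> mono y q -> mono (x * y) (p \+ q).
Proof. exact: is_monomialM. Qed.
Let monoV x p : mono x p -> mono x^-1 (\- p).
Proof. exact: is_monomialV. Qed.

Let trilog_mono x y z p q r : mono x p -> mono y q -> mono z r ->
  (dlog D x : F^o) ⊗ (ux y ∧ ux z) = trilog 10 D v (p, q, r).
Proof. by move=> [_ _ dx] [_ uy _] [_ uz _]; rewrite dx uy uz. Qed.

Lemma tau0_gen_trilog (i : nat) : (i < 5)%N ->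
  tau0_gen D w (del (inord i) l) = \sum_(t <- tau0_exps i) trilog 10 D v t.
Proof.
move=> i5; have bumpP j : (j < 4)%N -> (bump i j < 5)%N && (i != bump i j).
  by move: i j i5 => [|[|[|[|[|]]]]] [|[|[|[|]]]].
rewrite (@tau0_genE _ _ _ _ _ (fun k => v (pair_index i (bump i k)))); last first.
  move=> k; have /andP[b5 ib] := bumpP k (ltn_ord k).
  rewrite /Delta_omit omit_del /v Delta_pairE // /Delta_omit.
  by congr (w _`_0 _`_1 _`_2); congr (omit (pred2 _ _) _);
     apply: val_inj; rewrite /= !inordK.
rewrite big_map big_seq [RHS]big_seq; apply: eq_bigr => j; rewrite mem_iota /= => j4.
have mon k : (k < 4)%N -> mono (v (pair_index i (bump i k))) (pair_exp i (bump i k)).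
  by move=> /bumpP/andP[b5 ib]; apply: mono_pair.
rewrite trilogZ rmorphXn rmorphN1; congr (_ *: _).
by apply: trilog_mono; do ?[apply: monoM|apply: monoV];
   apply: mon; rewrite ?ltn_pmod.
Qed.

Lemma partialD_tau1_trilog (i : nat) : (i < 5)%N ->
  let r := proj_cross_ratio_omit w (val l) (inord i) in
  let P := \prod_(j < 5 | j != inord i) Delta_omit w (pred2 (inord i) j) (val l) in
  partialD (on_Fbb (@dbr F D) r ⊗ ux P, (dlog D P : F^o) ⊗ on_Fbb (@B2_cl F) r) =
  \sum_(t <- tau1_exps i) trilog 10 D v t.
Proof.
move=> i5 r P; have [rE r1E] := proj_cross_ratio_omitE hV hw l i5.
have mr : mono r (ratio_exp i).
  rewrite /r rE; apply: monoM; last apply: monoV; apply: monoM; apply: mono_pair;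
  by move: (i) i5 => [|[|[|[|[|]]]]].
have mr1 : mono (1 - r) (coratio_exp i).
  rewrite /r r1E; apply: monoM; last apply: monoV; apply: monoM; apply: mono_pair;
  by move: (i) i5 => [|[|[|[|[|]]]]].
have mP : mono P (prod_exp i).
  have bE k : (k < 4)%N -> (bump i k < 5)%N && (i != bump i k).
    by move: i k i5 {r P rE r1E mr mr1} => [|[|[|[|[|]]]]] [|[|[|[|]]]].
  (* The indices other than [i] are listed as [bump i k], which gives the product the four factors
     of [prod_exp]. *)
  have PE : P = \prod_(k < 4) v (pair_index i (bump i k)).
    transitivity (\prod_(j <- [seq j <- enum 'I_5 | j != inord i])
                    Delta_omit w (pred2 (inord i) j) (val l)).
      by rewrite big_filter big_enum_cond.
    rewrite enum_I5_lift big_map big_enum; apply: eq_bigr => k _.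
    have /andP[b5 ib] := bE k (ltn_ord k); rewrite /v Delta_pairE //.
    by congr (Delta_omit w (pred2 _ _) _); apply: val_inj; rewrite /= !inordK.
  rewrite {}PE 3!big_ord_recl big_ord1.
  apply: monoM; last apply: monoM; last apply: monoM; apply: mono_pair;
  by move: (i) i5 => [|[|[|[|[|]]]]].
(* Both [r] and [1 - r] are monomials, hence nonzero, so [on_Fbb] takes its genuine value. *)
have r01 : (r != 0) && (r != 1).
  case: mr mr1 => r0 _ _ [r1 _ _]; rewrite r0; apply: contraNneq r1 => ->.
  by rewrite subrr.
rewrite !(on_FbbE _ r01) (partialDE hD) /= !big_cons big_nil addr0.
rewrite (trilog_mono mr1 mr mP) (trilog_mono mr mr1 mP) (trilog_mono mP mr1 mr).
by rewrite addrA; congr (_ + _ + _); rewrite trilogN.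
Qed.

Lemma square_gen : (3%:R : F) != 0 ->
  \sum_(i < 5) tau0_gen D w (del i l) *~ (-1) ^+ i = partialD (tau1_gen D w l).
Proof.
move=> h3; rewrite /tau1_gen (linear_scale_sum _ _ _ (@partialD_linear F D)).
(* Multiplication by 3 is injective and turns the factor -1/3 into -1, so that the claim becomes the
   vanishing of a sum. *)
apply: (scalerI h3); rewrite scalerA mulrN mulfV // scaleN1r; apply/eqP.
rewrite -addr_eq0; apply/eqP.
rewrite -[RHS](sum_trilog_eq0 D v square_exps_symmetric).
rewrite big_flatten big_map scaler_sumr -big_split.
rewrite -[iota 0 5]/(index_iota 0 5) big_mkord; apply: eq_bigr => i _.
rewrite big_cat [LHS]/=.
have := tau0_gen_trilog (ltn_ord i); have := partialD_tau1_trilog (ltn_ord i).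
rewrite !inord_val; cbv zeta => -> ->; congr (_ + _).
  rewrite big_map -scaler_int scalerA scaler_sumr; apply: eq_bigr => -[[p q] r] _ /=.
  by rewrite trilogZ rmorphM.
rewrite big_map scaler_sumr; apply: eq_bigr => -[[p q] r] _ /=.
by rewrite trilogZ rmorphXn rmorphN1.
Qed.
End Faces.

Theorem theorem3p10 (F : fieldType) (h3 : (3%:R : F) != 0)
    (D : F -> F) (hD : derivation D)
    (V : vectType F) (hV : \dim {:V} = 3%N)
    (w : V -> V -> V -> F) (hw : volume_form w)
    (x : Cfg V 5) :
  eq_mod_2torsion (tau0 D w (cfg_d 4 x)) (partialD (tau1 D w x)).
Proof.
have tau0B := tau0_additive hD hV hw.
have -> : tau0 D w (cfg_d 4 x) = partialD (tau1 D w x); last first.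
  by rewrite /eq_mod_2torsion subrr mul0rn.
(* [cfg_d] and [tau1] are by definition evaluated on repr x, so only [tau0] has to
   be compatible with the action of GL(V). *)
have -> : tau0 D w (cfg_d 4 x) = zlift (tau0 D w \o (fun l : gtuple V 5 =>
    \sum_(i < 5) cfg_cl (del i l) *~ (-1) ^+ i)) (repr x) := zlift_comp _ _ tau0B.
have -> : partialD (tau1 D w x) = zlift (@partialD F D \o tau1_gen D w) (repr x)
  := zlift_comp _ _ (@partialD_additive F D).
apply: eq_zlift => l; rewrite /= -(square_gen hD hV hw l h3).
pose t0 : {additive Cfg V 4 -> tensor F^o (Fx_wedge2 F)} :=
  HB.pack (@tau0 F V D w) (GRing.isZmodMorphism.Build _ _ (@tau0 F V D w) tau0B).
rewrite -[tau0 D w]/(t0 : _ -> _) raddf_sum; apply: eq_bigr => i _.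
by rewrite raddfMz /= (tau0_cl hD hV hw).
Qed.
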